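(* For any formula $\phi_0\in\Phi$: if $w\Vdash\phi_0$ for every epistemic world $w\in W$ of every Kripke model with evidence $\langle W,E,\{\sim_e\}_{e\in E},\pi\rangle$, then $\vdash\phi_0$.
   Context: Fix an infinite set of propositional variables. The set $\Phi$ of formulae is given by $\phi ::= p \mid \neg\phi \mid \phi\to\phi \mid \boxdot\phi \mid \Box\phi$, where $p$ ranges over propositional variables. The logical system consists of all propositional tautologies in the language $\Phi$ together with the axioms (for all formulae $\phi,\psi$): Truth $\Box\phi\to\phi$; Negative Introspection $\neg\Box\phi\to\Box\neg\Box\phi$; Distributivity $\Box(\phi\to\psi)\to(\Box\phi\to\Box\psi)$; Monotonicity $\boxdot\phi\to\Box\phi$; Attainable Positive Introspection $\boxdot\phi\to\boxdot\boxdot\phi$; Attainable Distributivity $\boxdot(\phi\to\psi)\to(\boxdot\phi\to\boxdot\psi)$. The inference rules are Modus Ponens (from $\phi$ and $\phi\to\psi$ infer $\psi$) and Attainable Necessitation (from $\phi$ infer $\boxdot\phi$). We write $\vdash\phi$ if $\phi$ is derivable from the axioms using these two rules. A Kripke model with evidence is a tuple $\langle W,E,\{\sim_e\}_{e\in E},\pi\rangle$ where $W$ is a set (of epistemic worlds), $E$ is an arbitrary set (of evidence), each $\sim_e$ is an equivalence relation on $W$, and $\pi$ maps propositional variables to subsets of $W$. For $F\subseteq E$ write $w\sim_F u$ if $w\sim_e u$ for all $e\in F$. Satisfaction is defined by: $w\Vdash p$ iff $w\in\pi(p)$; $w\Vdash\neg\phi$ iff $w\nVdash\phi$; $w\Vdash\phi\to\psi$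 iff $w\nVdash\phi$ or $w\Vdash\psi$; $w\Vdash\boxdot\phi$ iff there is a finite $F\subseteq E$ such that $u\Vdash\phi$ for every $u\in W$ with $w\sim_F u$; $w\Vdash\Box\phi$ iff $u\Vdash\phi$ for every $u\in W$ with $w\sim_E u$. *)

(* Defs.v *)
From mathcomp Require Import all_boot.
From mathcomp Require Import boolp classical_sets functions cardinality.
From Stdlib Require Import RelationClasses.

Set Implicit Arguments.
Unset Strict Implicit.
Unset Printing Implicit Defensive.

Local Open Scope classical_set_scope.

(* [ABox] is the boxdot modality. *)
Inductive formula (V : Type) : Type :=
| Var of V
| Neg of formula V
| Imp of formula V & formula V
| ABox of formula V
| Box of formula V.

(* Propositional variables and formulae headed by a modality are the
   propositional atoms; [a] gives their truth values, and its values at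
   negations and implications are ignored. *)
Fixpoint prop_eval (V : Type) (a : formula V -> bool) (phi : formula V) : bool :=
  match phi with
  | Neg psi => ~~ prop_eval a psi
  | Imp psi chi => prop_eval a psi ==> prop_eval a chi
  | Var _ | ABox _ | Box _ => a phi
  end.

Definition tautology (V : Type) (phi : formula V) : Prop :=
  forall a : formula V -> bool, prop_eval a phi.

Inductive derivable (V : Type) : formula V -> Prop :=
| Taut phi : tautology phi -> derivable phi
| Truth phi : derivable (Imp (Box phi) phi)
| NegativeIntrospection phi :
    derivable (Imp (Neg (Box phi)) (Box (Neg (Box phi))))
| Distributivity phi psi :
    derivable (Imp (Box (Imp phi psi)) (Imp (Box phi) (Box psi)))
| Monotonicity phi : derivable (Imp (ABox phi) (Box phi))
| AttainablePositiveIntrospection phi :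
    derivable (Imp (ABox phi) (ABox (ABox phi)))
| AttainableDistributivity phi psi :
    derivable (Imp (ABox (Imp phi psi)) (Imp (ABox phi) (ABox psi)))
| ModusPonens phi psi :
    derivable phi -> derivable (Imp phi psi) -> derivable psi
| AttainableNecessitation phi : derivable phi -> derivable (ABox phi).

(* Neither [world] nor [evidence] is required to be inhabited. *)
Record evidence_model (V : Type) := EvidenceModel {
  world : Type;
  evidence : Type;
  indist : evidence -> world -> world -> Prop;
  indist_equiv : forall e, Equivalence (indist e);
  valuation : V -> set world
}.
Arguments valuation {V} M p : rename.
Arguments indist_equiv {V} M e : rename.

Definition indist_set (V : Type) (M : evidence_model V) (F : set (evidence M))
    (w u : world M) : Prop :=
  forall e, F e -> indist e w u.

Fixpoint satisfies (V : Type) (M : evidence_model V) (w : world M)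
    (phi : formula V) : Prop :=
  match phi with
  | Var p => valuation M p w
  | Neg psi => ~ satisfies w psi
  | Imp psi chi => ~ satisfies w psi \/ satisfies w chi
  | ABox psi => exists F : set (evidence M),
      finite_set F /\ forall u, indist_set F w u -> satisfies u psi
  | Box psi => forall u, indist_set [set: evidence M] w u -> satisfies u psi
  end.

(* Main.v *)
Require Import Defs.
From mathcomp Require Import all_boot.
From mathcomp Require Import boolp classical_sets functions cardinality.
From Stdlib Require Import RelationClasses.

(** Let [W] be the set of maximal consistent sets, [R] the accessibility preorder
    of the attainable modality and [~] the equivalence relation of [Box]; then
    [~] is contained in [R].  The frame [W] is unravelled into a model with
    evidence whose worlds are pairs [(s, w)], where [s] is an infinite [R]-path
    that is eventually [~]-equivalent to [w], and where the [n]-th piece of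
    evidence identifies two paths with [~]-equivalent [n]-th terms.  A late enough
    piece of evidence confines the endpoint to the [R]-successors of [w], while
    finitely many pieces only constrain an initial segment, after which the path
    may still jump to any [R]-successor of [w].  All the pieces together determine
    the endpoint exactly up to [~]. *)

Set Implicit Arguments.
Unset Strict Implicit.
Unset Printing Implicit Defensive.

Local Open Scope classical_set_scope.

Section Completeness.
Variable V : Type.
Implicit Types (phi psi chi : formula V) (G A B X : set (formula V)).

(** * Derivability from hypotheses *)

(* Necessitation is not a rule here: it applies only to [derivable] formulae. *)
Inductive proves G : formula V -> Prop :=
| proves_hyp phi : G phi -> proves G phi
| proves_thm phi : derivable phi -> proves G phi
| proves_mp phi psi : proves G phi -> proves G (Imp phi psi) -> proves G psi.

Lemma proves_cut G X phi :
  (forall psi, G psi -> proves X psi) -> proves G phi -> proves X phi.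
Proof.
move=> GX; elim=> [psi /GX //|psi ?|psi chi _ IH1 _ IH2]; first exact: proves_thm.
exact: proves_mp IH1 IH2.
Qed.

Lemma proves_sub G X phi : G `<=` X -> proves G phi -> proves X phi.
Proof. by move=> GX; apply: proves_cut => psi /GX; apply: proves_hyp. Qed.

Lemma proves_set0 phi : proves set0 phi -> derivable phi.
Proof. by elim=> // psi chi _ IH1 _; apply: ModusPonens IH1. Qed.

Lemma deduction G psi phi :
  proves (G `|` [set psi]) phi -> proves G (Imp psi phi).
Proof.
elim=> [chi [Gchi|->]|chi dchi|chi xi _ IH1 _ IH2].
- apply: (proves_mp (proves_hyp Gchi)); apply/proves_thm/Taut => a /=.
  by do !case: prop_eval.
- by apply/proves_thm/Taut => a /=; case: prop_eval.
- apply: (proves_mp (proves_thm G dchi)); apply/proves_thm/Taut => a /=.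
  by do !case: prop_eval.
- apply: (proves_mp IH2); apply: (proves_mp IH1); apply/proves_thm/Taut => a /=.
  by do !case: prop_eval.
Qed.

(** The two premises of a modus ponens use comparable members of the chain, so the larger one serves
    both. The extra member [set0] covers the empty chain. *)
Lemma proves_chain G (F : set (set (formula V))) phi :
  total_on F subset -> proves (G `|` \bigcup_(X in F) X) phi ->
  exists2 X, (F `|` [set set0]) X & proves (G `|` X) phi.
Proof.
move=> totF; elim=> [psi [Gpsi|[X FX Xpsi]]|psi dpsi|].
- by exists set0; [right|apply: proves_hyp; left].
- by exists X; [left|apply: proves_hyp; right].
- by exists set0; [right|apply: proves_thm].
- move=> psi chi _ [X FX pX] _ [Y FY pY].
  have [XY|YX] : X `<=` Y \/ Y `<=` X.
  + case: FX => [FX|->]; last by left.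
    by case: FY => [FY|->]; [exact: totF|right].
  + by exists Y => //; apply: proves_mp pY; apply: proves_sub pX; apply: setUS.
  + by exists X => //; apply: (proves_mp pX); apply: proves_sub pY; apply: setUS.
Qed.

(** * Maximal consistent sets *)

Definition maximal_consistent A : Prop :=
  (forall phi, proves A phi -> A phi) /\ (forall phi, A (Neg phi) <-> ~ A phi).

Lemma lindenbaum G phi : ~ proves G phi ->
  exists2 A, maximal_consistent A & G `<=` A /\ ~ A phi.
Proof.
move=> nGphi.
(* The union with [G] sits inside the predicate because the empty chain has union [set0], which need
   not contain [G]. *)
have [F FP totF|A [nA maxA]] := @Zorn_bigcup _ (fun X => ~ proves (G `|` X) phi).
  move=> /(proves_chain totF)[X [/FP//|->]].
  by rewrite setU0.
(* Adjoining an element of [G] to [A] leaves their union unchanged, so by maximality it already lies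
   in [A]. *)
have GA : G `<=` A.
  move=> psi Gpsi; apply: contrapT => nApsi; apply: (maxA (A `|` [set psi])).
    by split=> [x ?|/(_ psi)]; [left|move=> /(_ (or_intror erefl))].
  apply: contra_not nA; apply: proves_sub => x.
  by case=> [?|[?|->]]; [left|right|left].
rewrite (setUidr GA) in nA.
have extA psi : ~ A psi -> proves A (Imp psi phi).
  move=> nApsi; apply: deduction; apply: contrapT => np.
  apply: (maxA (A `|` [set psi])).
    by split=> [x ?|/(_ psi)]; [left|move=> /(_ (or_intror erefl))].
  by rewrite setUA (setUidr GA).
have closedA psi : proves A psi -> A psi.
  move=> Apsi; apply: contrapT => /extA Aimp; apply: nA.
  exact: proves_mp Apsi Aimp.
exists A; split=> //.
- move=> psi; split=> [An Ap|/extA Aimp].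
    apply: nA; apply: (proves_mp (proves_hyp An)).
    apply: (proves_mp (proves_hyp Ap)); apply/proves_thm/Taut => a /=.
    by do !case: prop_eval.
  apply: contrapT => /extA Animp; apply: nA.
  apply: (proves_mp Animp); apply: (proves_mp Aimp); apply/proves_thm/Taut => a /=.
  by do !case: prop_eval.
- by move/(proves_hyp (G := A)).
Qed.

Lemma mcs_mp A phi psi :
  maximal_consistent A -> derivable (Imp phi psi) -> A phi -> A psi.
Proof.
move=> [clA _] dimp Aphi; apply: clA.
exact: proves_mp (proves_hyp Aphi) (proves_thm _ dimp).
Qed.

Lemma mcs_imp A phi psi :
  maximal_consistent A -> A (Imp phi psi) <-> ~ A phi \/ A psi.
Proof.
move=> mA; have [clA negA] := mA; split.
  move=> Aimp; have [Aphi|] := pselect (A phi); last by left.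
  by right; apply: clA; apply: proves_mp (proves_hyp Aphi) (proves_hyp Aimp).
case=> [/negA|]; apply: (mcs_mp mA); apply: Taut => a /=; by do !case: prop_eval.
Qed.

(** Otherwise the formulae whose [m]-image lies in [A] would prove [phi]; necessitation and
    distributivity lift such a derivation to put [m phi] in [A]. The parameter [m] stands for either
    modality. *)
Lemma modal_witness (m : formula V -> formula V) A phi :
  (forall psi, derivable psi -> derivable (m psi)) ->
  (forall psi chi, derivable (Imp (m (Imp psi chi)) (Imp (m psi) (m chi)))) ->
  maximal_consistent A -> ~ A (m phi) ->
  exists2 B, maximal_consistent B & (forall psi, A (m psi) -> B psi) /\ ~ B phi.
Proof.
move=> nec distr mA nAm; apply: (@lindenbaum (fun psi => A (m psi))).
apply: contra_not nAm; elim=> // [psi /nec/(proves_thm A)|psi chi _ IH1 _ IH2].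
  by have [clA _] := mA; move/clA.
by have /(mcs_imp _ _ mA)[] := mcs_mp mA (distr psi chi) IH2.
Qed.

(** * Derived modal laws *)

Lemma derivable_trans phi psi chi :
  derivable (Imp phi psi) -> derivable (Imp psi chi) -> derivable (Imp phi chi).
Proof.
move=> d1 d2; apply: (ModusPonens d2); apply: (ModusPonens d1).
by apply: Taut => a /=; do !case: prop_eval.
Qed.

Lemma necessitation phi : derivable phi -> derivable (Box phi).
Proof.
move=> /AttainableNecessitation d; exact: ModusPonens d (Monotonicity phi).
Qed.

(** The S5 argument: [p] yields [Neg q] by Truth, Negative Introspection boxes [Neg q], and its
    contrapositive, used under the box, returns to [p]. *)
Lemma positive_introspection phi : derivable (Imp (Box phi) (Box (Box phi))).
Proof.
set p := Box phi; set q := Box (Neg p).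
have dpq : derivable (Imp p (Neg q)).
  apply: (ModusPonens (Truth (Neg p))).
  by apply: Taut => a; rewrite /q /p /=; case: (a _); case: (a _).
have dqp : derivable (Imp (Neg q) p).
  apply: (ModusPonens (NegativeIntrospection phi)).
  by apply: Taut => a; rewrite /q /p /=; case: (a _); case: (a _).
apply: (derivable_trans dpq).
apply: (derivable_trans (NegativeIntrospection (Neg p))).
exact: ModusPonens (necessitation dqp) (Distributivity (Neg q) p).
Qed.

(** * The canonical frame *)

Definition mcs := {A : set (formula V) | maximal_consistent A}.

Definition in_mcs (w : mcs) : set (formula V) := sval w.

Definition attainable (w u : mcs) := forall phi, in_mcs w (ABox phi) -> in_mcs u phi.

(** The S5 axioms make this the canonical relation of [Box], written so that it is visibly an
    equivalence. *)
Definition knows_same (w u : mcs) :=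
  forall phi, in_mcs w (Box phi) <-> in_mcs u (Box phi).

Lemma attainable_refl w : attainable w w.
Proof.
move=> phi; apply: (mcs_mp (svalP w)).
exact: derivable_trans (Monotonicity phi) (Truth phi).
Qed.

Lemma attainable_trans u w v : attainable w u -> attainable u v -> attainable w v.
Proof.
move=> wu uv phi wphi; apply/uv/wu.
exact: mcs_mp (svalP w) (AttainablePositiveIntrospection phi) wphi.
Qed.

Lemma knows_same_attainable w u : knows_same w u -> attainable w u.
Proof.
move=> wu phi wphi; apply: (mcs_mp (svalP u) (Truth phi)); apply/wu.
exact: mcs_mp (svalP w) (Monotonicity phi) wphi.
Qed.

Lemma knows_same_refl w : knows_same w w.
Proof. by []. Qed.

Lemma knows_same_sym w u : knows_same w u -> knows_same u w.
Proof. by move=> wu phi; rewrite wu. Qed.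

Lemma knows_same_trans u w v : knows_same w u -> knows_same u v -> knows_same w v.
Proof. by move=> wu uv phi; rewrite wu. Qed.

Lemma box_witness w phi : ~ in_mcs w (Box phi) ->
  exists2 u, knows_same w u & ~ in_mcs u phi.
Proof.
move=> nw.
have [B mB [wB nB]] := modal_witness necessitation (@Distributivity V) (svalP w) nw.
exists (exist _ B mB : mcs) => // psi; split=> [wpsi|Bpsi].
  exact: wB (mcs_mp (svalP w) (positive_introspection psi) wpsi).
have [_ negw] := svalP w; have [_ negB] := mB.
apply: contrapT => /negw /(mcs_mp (svalP w) (NegativeIntrospection psi)) /wB.
by move/negB.
Qed.

Lemma abox_witness w phi : ~ in_mcs w (ABox phi) ->
  exists2 u, attainable w u & ~ in_mcs u phi.
Proof.
move=> nw.
have [B mB [wB nB]] := modal_witness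
  (@AttainableNecessitation V) (@AttainableDistributivity V) (svalP w) nw.
by exists (exist _ B mB : mcs).
Qed.

(** * The model of paths *)

Record path_world := PathWorld {
  path : nat -> mcs;
  endpoint : mcs;
  path_step : forall n, attainable (path n) (path n.+1);
  path_end : exists N, forall n, N <= n -> knows_same (path n) endpoint
}.
Arguments path_step : clear implicits.

Lemma path_attainable (s : path_world) n m : n <= m -> attainable (path s n) (path s m).
Proof.
move=> /subnK <-; elim: (m - n) => [|k IH]; first exact: attainable_refl.
exact: attainable_trans IH (path_step s _).
Qed.
Arguments path_attainable s {n m} _ phi _.

Lemma endpoint_attainable (s : path_world) n : attainable (path s n) (endpoint s).
Proof.
have [N sN] := path_end s.
apply: attainable_trans (path_attainable s (leq_maxl n N)) _.
exact/knows_same_attainable/sN/leq_maxr.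
Qed.
Arguments endpoint_attainable : clear implicits.

Definition same_term n (s t : path_world) := knows_same (path s n) (path t n).

Lemma same_term_equiv n : Equivalence (same_term n).
Proof.
split=> [s|s t|s t r].
- exact: knows_same_refl.
- exact: knows_same_sym.
- exact: knows_same_trans.
Qed.

Definition path_model : evidence_model V :=
  EvidenceModel same_term_equiv (fun p => [set s | in_mcs (endpoint s) (Var p)]).

Lemma endpoint_knows_same (s t : path_world) :
  (forall n, same_term n s t) -> knows_same (endpoint s) (endpoint t).
Proof.
move=> st; have [[N sN] [M tM]] := (path_end s, path_end t).
apply: knows_same_trans (tM (maxn N M) (leq_maxr _ _)).
apply: knows_same_trans (st _).
exact/knows_same_sym/sN/leq_maxl.
Qed.

(** The path itself is kept, since [path_end] constrains the endpoint only up to [knows_same]. *)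
Lemma change_endpoint (s : path_world) v : knows_same (endpoint s) v ->
  exists2 t : path_world, (forall n, same_term n s t) & endpoint t = v.
Proof.
move=> sv.
have tail : exists N, forall n, N <= n -> knows_same (path s n) v.
  have [N sN] := path_end s; exists N => n /sN sn; exact: knows_same_trans sn sv.
by exists (PathWorld (path_step s) tail) => // n; exact: knows_same_refl.
Qed.

(** After its [K]-th term the path may stay at [v] forever, because that term reaches [endpoint s]
    and hence [v]. *)
Lemma redirect (s : path_world) K v : attainable (endpoint s) v ->
  exists2 t : path_world, (forall n, n <= K -> same_term n s t) & endpoint t = v.
Proof.
move=> sv; pose r n := if n <= K then path s n else v.
have step n : attainable (r n) (r n.+1).
  rewrite /r; case: (leqP n.+1 K) => [nK|_]; first by rewrite (ltnW nK); apply: path_step.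
  case: ifP => _; last exact: attainable_refl.
  exact: attainable_trans (endpoint_attainable s n) sv.
have tail : exists N, forall n, N <= n -> knows_same (r n) v.
  by exists K.+1 => n; rewrite /r ltnNge => /negbTE ->; exact: knows_same_refl.
exists (PathWorld step tail) => // n nK.
by rewrite /same_term /= /r nK; exact: knows_same_refl.
Qed.

(** * Truth lemma and completeness *)

Lemma finite_set_bounded (F : set nat) :
  finite_set F -> exists K, forall n, F n -> n <= K.
Proof.
move=> /finite_seqP[l ->]; exists (\max_(i <- l) i) => n /= nl.
exact: (@leq_bigmax_seq _ l xpredT id).
Qed.

Lemma truth_lemma phi (s : world path_model) :
  satisfies s phi <-> in_mcs (endpoint s) phi.
Proof.
elim: phi s => [p|phi IH|phi IH1 psi IH2|phi IH|phi IH] s //=.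
- by have [_ negs] := svalP (endpoint s); rewrite IH; apply: iff_sym; apply: negs.
- by rewrite IH1 IH2; apply: iff_sym; exact: mcs_imp (svalP (endpoint s)).
- split=> [[F [/finite_set_bounded[K FK] Fphi]]|sphi].
    apply: contrapT => /abox_witness[v sv nv].
    (* No evidence in [F] looks past term [K], so [F] cannot tell the redirected path from [s]. *)
    have [t st tv] := redirect K sv; apply: nv; rewrite -tv; apply/IH/Fphi.
    by move=> n /FK; apply: st.
  have [N sN] := path_end s; exists [set N]; split; first exact: finite_set1.
  (* Generalizing [phi] leaves [attainable (endpoint s) (endpoint t)]: term [N] of [t] is equivalent
     to that of [s], hence to [endpoint s], and it reaches [endpoint t]. *)
  move=> t /(_ N erefl) stN; apply/IH; move: (phi) sphi.
  apply: attainable_trans (endpoint_attainable t N); apply: knows_same_attainable.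
  apply: knows_same_trans stN; exact/knows_same_sym/sN.
- split=> [all_phi|sphi t st].
    apply: contrapT => /box_witness[v sv nv].
    have [t st tv] := change_endpoint sv; apply: nv; rewrite -tv; apply/IH/all_phi.
    by move=> n _; apply: st.
  apply/IH; apply: (mcs_mp (svalP (endpoint t)) (Truth phi)).
  by apply/(endpoint_knows_same (s := s)) => // n; apply: st.
Qed.

Lemma completeness phi :
  (forall (M : evidence_model V) (w : world M), satisfies w phi) -> derivable phi.
Proof.
move=> valid; apply: contrapT => nphi.
have [|A mA [_ nA]] := @lindenbaum set0 phi; first by move/proves_set0.
pose w : mcs := exist _ A mA.
have tail : exists N, forall n : nat, N <= n -> knows_same w w by exists 0.
(* The constant path puts the refuting set [w] at the endpoint of a world. *)
apply: nA; pose s := @PathWorld (fun=> w) w (fun=> @attainable_refl w) tail.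
exact/(truth_lemma phi s)/valid.
Qed.

End Completeness.

Theorem theorem2 (V : Type) (V_infinite : infinite_set [set: V]%classic)
    (phi0 : formula V) :
  (forall (M : evidence_model V) (w : world M), satisfies w phi0) ->
  derivable phi0.
Proof. exact: completeness. Qed.
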